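(* For every integer $n\ge 3$, both voting profiles $R_n$ and $\tilde R_n$ (defined in the context) generate the majority graph $G_n=([2^n],E_n)$. Moreover, if $(i,j)\in E_n$, then $i$ precedes $j$ in exactly $2n$ preference lists (rows) of $R_n$, whereas $j$ precedes $i$ in exactly $2n-2$ preference lists of $R_n$.
   Context: For a positive integer $m$, $[m]=\{1,\dots,m\}$. A voting profile on a finite set $V$ of candidates is a matrix each of whose rows (called preference lists, one per voter) is a permutation of the elements of $V$; its size $\#R$ is its number of rows. Candidate $a$ is preferred to $b$ by a voter if $a$ precedes $b$ in the voter's row. The majority graph of $R$ is the directed graph with vertex set $V$ in which $(a,b)$, $a\neq b$, is an arrow if and only if $a$ precedes $b$ in more than half of the rows of $R$; $R$ generates $G$ if $G$ is the majority graph of $R$. Graph $G_3=([8],E_3)$: $E_3$ consists of the 28 arrows $(1,2),(1,3),(1,5),(2,3),(2,4),(2,6),(2,7),$ $(3,4),(3,5),(3,6),(3,8),(4,1),(4,5),(4,8),$ $(5,2),(5,6),(5,7),(6,1),(6,4),(6,7),(6,8),$ $(7,1),(7,3),(7,4),(7,8),(8,1),(8,2),(8,5).$ Graph $G_n=([2^n],E_n)$ for $n\ge 4$: for $q\in[2^{n-3}]$ let $C_q=[8q]\setminus[8(q-1)]$; these classes partition $[2^n]$. For $i,j$ in the same class $C_q$, $(i,j)\in E_n$ if and only if $(i-8(q-1),j-8(q-1))\in E_3$. For $i<j$ in different classes, $(i,j)\in E_n$ if $i+j$ is even, and $(j,i)\in E_n$ if $i+j$ is odd. Profile $R_3$ on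 $[8]$ has the ten rows, in order: $(8,1,5,2,3,4,6,7)$, $(2,7,6,4,1,3,5,8)$, $(2,7,3,6,4,5,8,1)$, $(4,1,3,8,5,6,7,2)$, $(3,5,2,6,7,1,4,8)$, $(6,8,4,1,5,7,2,3)$, $(6,7,3,4,8,1,2,5)$, $(8,5,2,7,1,4,3,6)$, $(7,8,5,6,3,4,1,2)$, $(1,2,3,4,5,6,7,8)$. Operations: for row vectors, $(u_1,\dots,u_N)$ denotes concatenation, and $\bar u$ is $u$ in reverse order. For matrices with the same number of columns, $(M_1,\dots,M_N)_V$ is the matrix obtained by stacking all the rows of $M_1,\dots,M_N$ vertically in this order. $R+a\cdot\boldsymbol{1}$ is $R$ with $a$ added to every entry. For profiles $R^{(1)},R^{(2)}$ on disjoint candidate sets with the same even size $2r$, $R^{(1)}\bowtie R^{(2)}$ is the profile of size $2r$ on the union of the candidate sets whose $s$-th row is $(R^{(1)}_{s,\cdot},R^{(2)}_{s,\cdot})$ for $s$ odd and $(R^{(2)}_{s,\cdot},R^{(1)}_{s,\cdot})$ for $s$ even. For $n\ge 4$ define the vectors (entries in increasing order) $A^{(n)}_1=(1,3,\dots,2^{n-1}-1)$, $B^{(n)}_1=(2^{n-1}+1,2^{n-1}+3,\dots,2^n-1)$, $A^{(n)}_2=(2,4,\dots,2^{n-1})$, $B^{(n)}_2=(2^{n-1}+2,2^{n-1}+4,\dots,2^n)$, and the preference lists $v^{(n)}_1=(A^{(n)}_1,B^{(n)}_1,A^{(n)}_2,B^{(n)}_2)$, $v^{(n)}_2=(\bar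 A^{(n)}_2,\bar B^{(n)}_2,\bar A^{(n)}_1,\bar B^{(n)}_1)$, $v^{(n)}_3=(B^{(n)}_1,A^{(n)}_2,B^{(n)}_2,A^{(n)}_1)$, $v^{(n)}_4=(\bar B^{(n)}_2,\bar A^{(n)}_1,\bar B^{(n)}_1,\bar A^{(n)}_2)$. Recursively, for $n\ge 4$, $$R_n=\Big(v^{(n)}_1,v^{(n)}_2,v^{(n)}_3,v^{(n)}_4,\big[R_{n-1}\bowtie(R_{n-1}+2^{n-1}\cdot\boldsymbol{1})\big]\Big)_V .$$ Thus $\#R_n=4n-2$. For $n\ge3$, $\tilde R_n$ is $R_n$ with its last row deleted, so $\#\tilde R_n=4n-3$. *)

(* Defs.v *)
From mathcomp Require Import all_boot.

Set Implicit Arguments.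
Unset Strict Implicit.
Unset Printing Implicit Defensive.

(* The set [m] = {1, ..., m}; candidates are numbered from 1. *)
Definition cands (m : nat) : seq nat := iota 1 m.

(* A preference list is the sequence of candidates in order of preference;
   a profile is the sequence of its rows. *)
Definition profile := seq (seq nat).

Definition is_profile (V : seq nat) (R : profile) : bool := all (perm_eq V) R.

(* The bound by size r makes this false unless both a and b occur in r. *)
Definition precedes (a b : nat) (r : seq nat) : bool :=
  index a r < index b r < size r.

Definition majority_arrow (V : seq nat) (R : profile) : rel nat :=
  fun a b => [&& a \in V, b \in V, a != b
               & size R < 2 * count (precedes a b) R].

(* Directed graphs on V are given by V and their arrow relation, which is
   required to be false outside V. *)
Definition generates (V : seq nat) (E : rel nat) (R : profile) : Prop :=
  is_profile V R /\ forall i j, E i j = majority_arrow V R i j.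

Definition arrows3 : seq (nat * nat) :=
  [:: (1, 2); (1, 3); (1, 5); (2, 3); (2, 4); (2, 6); (2, 7);
      (3, 4); (3, 5); (3, 6); (3, 8); (4, 1); (4, 5); (4, 8);
      (5, 2); (5, 6); (5, 7); (6, 1); (6, 4); (6, 7); (6, 8);
      (7, 1); (7, 3); (7, 4); (7, 8); (8, 1); (8, 2); (8, 5)].

Definition E3 : rel nat := fun i j => (i, j) \in arrows3.

Definition C (q : nat) : pred nat :=
  fun i => (i \in cands (8 * q)) && (i \notin cands (8 * (q - 1))).

Definition same_class (n i j : nat) : bool :=
  has (fun q => C q i && C q j) (cands (2 ^ (n - 3))).

Definition class_arrow (n i j : nat) : bool :=
  has (fun q => [&& C q i, C q j & E3 (i - 8 * (q - 1)) (j - 8 * (q - 1))])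
      (cands (2 ^ (n - 3))).

(* Only meaningful for n >= 3. For i, j in different classes there is an
   arrow (i, j) with i < j iff i + j is even, and an arrow (i, j) with j < i
   iff i + j is odd. *)
Definition E (n : nat) : rel nat := fun i j =>
  if n == 3 then E3 i j else
  [&& i \in cands (2 ^ n), j \in cands (2 ^ n)
    & if same_class n i j then class_arrow n i j
      else ((i < j) && ~~ odd (i + j)) || ((j < i) && odd (i + j))].

Definition R3 : profile :=
  [:: [:: 8; 1; 5; 2; 3; 4; 6; 7];
      [:: 2; 7; 6; 4; 1; 3; 5; 8];
      [:: 2; 7; 3; 6; 4; 5; 8; 1];
      [:: 4; 1; 3; 8; 5; 6; 7; 2];
      [:: 3; 5; 2; 6; 7; 1; 4; 8];
      [:: 6; 8; 4; 1; 5; 7; 2; 3];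
      [:: 6; 7; 3; 4; 8; 1; 2; 5];
      [:: 8; 5; 2; 7; 1; 4; 3; 6];
      [:: 7; 8; 5; 6; 3; 4; 1; 2];
      [:: 1; 2; 3; 4; 5; 6; 7; 8]].

Definition shift (a : nat) (R : profile) : profile :=
  [seq [seq x + a | x <- r] | r <- R].

(* Rows are numbered from s = 1; R and S are meant to have the same size. *)
Definition bowtie (R S : profile) : profile :=
  [seq (if odd s then nth [::] R s.-1 ++ nth [::] S s.-1
        else nth [::] S s.-1 ++ nth [::] R s.-1) | s <- iota 1 (size R)].

Definition A1 (n : nat) := [seq k <- iota 1 (2 ^ n.-1) | odd k].
Definition B1 (n : nat) := [seq k <- iota (2 ^ n.-1).+1 (2 ^ n.-1) | odd k].
Definition A2 (n : nat) := [seq k <- iota 1 (2 ^ n.-1) | ~~ odd k].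
Definition B2 (n : nat) := [seq k <- iota (2 ^ n.-1).+1 (2 ^ n.-1) | ~~ odd k].

Definition v1 (n : nat) := A1 n ++ B1 n ++ A2 n ++ B2 n.
Definition v2 (n : nat) := rev (A2 n) ++ rev (B2 n) ++ rev (A1 n) ++ rev (B1 n).
Definition v3 (n : nat) := B1 n ++ A2 n ++ B2 n ++ A1 n.
Definition v4 (n : nat) := rev (B2 n) ++ rev (A1 n) ++ rev (B1 n) ++ rev (A2 n).

(* The value for n < 3 is junk. *)
Fixpoint Rprof (n : nat) : profile :=
  if n is m.+1 then
    if n < 3 then [::]
    else if n == 3 then R3
    else [:: v1 n; v2 n; v3 n; v4 n] ++ bowtie (Rprof m) (shift (2 ^ m) (Rprof m))
  else [::].

Definition Rtilde (n : nat) : profile := take (size (Rprof n)).-1 (Rprof n).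

(* Main.v *)
Require Import Defs.
From mathcomp Require Import all_boot zify.

(** By induction on [n], a candidate [i] precedes [j <> i] in [2n] rows of
    [R_n] if [(i, j)] is an arrow and in [2n - 2] rows otherwise.  If [i] and
    [j] lie in the same half of [[2^n]], then [v_1], [v_2] order them oppositely,
    and so do [v_3], [v_4], so these rows add 2 to the count coming from
    [R_(n-1)].  If they lie in different halves, then the rows of the bowtie
    alternate and contribute [2n - 3], while exactly three of [v_1, ..., v_4]
    order [i] and [j] as the parity rule prescribes. *)

(** * Precedence under concatenation, reversal and relabelling *)

Lemma precedes_cat a b r1 r2 :
  precedes a b (r1 ++ r2) =
  if b \in r1 then precedes a b r1
  else (b \in r2) && ((a \in r1) || precedes a b r2).
Proof.
rewrite /precedes !index_cat size_cat -(index_mem b r1) -(index_mem b r2).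
rewrite -(index_mem a r1).
have := index_size a r1; have := index_size b r1.
have := index_size a r2; have := index_size b r2.
rewrite /=.
by do ?case: ifP; lia.
Qed.

Lemma precedes_notin a b r : a \notin r -> precedes a b r = false.
Proof.
by rewrite -index_mem /precedes; have := index_size b r; lia.
Qed.

Lemma precedes_rev a b r : uniq r -> a != b -> a \in r -> b \in r ->
  precedes a b (rev r) = ~~ precedes a b r.
Proof.
move=> + neq_ab; elim: r => // x r IHr /= /andP[xNr uniq_r].
rewrite rev_cons -cats1 -cat1s !precedes_cat !mem_rev !inE.
have [eax|nax] := eqVneq a x; have [ebx|nbx] := eqVneq b x => //=.
- by rewrite eax ebx eqxx in neq_ab.
- by move=> _ bR; rewrite bR eax precedes_notin ?mem_rev.
- by move=> aR _; rewrite ebx (negPf xNr) aR precedes_notin // inE.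
by move=> aR bR; rewrite bR IHr.
Qed.

Lemma precedes_map f (f_inj : injective f) a b r :
  precedes (f a) (f b) (map f r) = precedes a b r.
Proof. by rewrite /precedes !index_map // size_map. Qed.

(** * The four block rows $v_1, \dots, v_4$ *)

Lemma mem_cands m i : (i \in cands m) = (0 < i <= m).
Proof. by rewrite mem_iota; lia. Qed.

Lemma mem_blocks n i (h := 2 ^ n.-1) : i \in cands (h + h) ->
  [/\ (i \in A1 n) = odd i && (i <= h), (i \in B1 n) = odd i && (h < i),
      (i \in A2 n) = ~~ odd i && (i <= h) & (i \in B2 n) = ~~ odd i && (h < i)].
Proof. by rewrite mem_cands => hi; split; rewrite mem_filter mem_iota; lia. Qed.

Lemma uniq_blocks n : [&& uniq (A1 n), uniq (B1 n), uniq (A2 n) & uniq (B2 n)].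
Proof. by rewrite !filter_uniq ?iota_uniq. Qed.

Lemma ltn_separated h i j : (i <= h) != (j <= h) -> (i < j) = (i <= h).
Proof. by case: leqP; case: leqP => //; lia. Qed.

(** Parity and half determine the block of a candidate, and the order of the blocks settles each row
    unless [i] and [j] share a block. A shared block is read forwards in [v1], [v3] and backwards in
    [v2], [v4], which gives 2. *)
Lemma count_v n i j (h := 2 ^ n.-1) :
  i \in cands (h + h) -> j \in cands (h + h) -> i != j ->
  count (precedes i j) [:: v1 n; v2 n; v3 n; v4 n] =
  if (i <= h) == (j <= h) then 2
  else if (i < j) == ~~ odd (i + j) then 3 else 1.
Proof.
move=> /mem_blocks[iA1 iB1 iA2 iB2] /mem_blocks[jA1 jB1 jA2 jB2] neq_ij.
case/and4P: (uniq_blocks n) => uA1 uB1 uA2 uB2.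
(* For candidates in different halves, [i < j] only says which half holds [i]; after this rewriting
   the claim depends on four Booleans, the parities and the halves. *)
have -> : (if (i <= h) == (j <= h) then 2
            else if (i < j) == ~~ odd (i + j) then 3 else 1) =
          (if (i <= h) == (j <= h) then 2
           else if (i <= h) == ~~ odd (i + j) then 3 else 1).
  by case: eqP => // /eqP/ltn_separated->.
(* The guard [i \in s] makes the precedence terms vanish for every block that does not contain
   [i]. *)
have precE s : precedes i j s = (i \in s) && precedes i j s.
  by case: (boolP (i \in s)) => //= /precedes_notin.
have revE s : uniq s -> j \in s ->
  precedes i j (rev s) = (i \in s) && ~~ precedes i j s.
  by move=> us js; case: (boolP (i \in s)) => [si|si];
    [rewrite precedes_rev | rewrite precedes_notin ?mem_rev].
rewrite /v1 /v2 /v3 /v4 /= !precedes_cat !mem_cat !mem_rev.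
rewrite (precE (A1 n)) (precE (B1 n)) (precE (A2 n)) (precE (B2 n)).
move: iA1 iB1 iA2 iB2 jA1 jB1 jA2 jB2; rewrite oddD -/h !(ltnNge h).
case: (odd i); case: (odd j); case: (i <= h); case: (j <= h) => /=;
  move=> iA1 iB1 iA2 iB2 jA1 jB1 jA2 jB2;
  rewrite ?iA1 ?iB1 ?iA2 ?iB2 ?jA1 ?jB1 ?jA2 ?jB2 /= ?revE //;
  (* What is left is the case of a common block, where the unknown order inside it occurs twice
     plain and twice negated. *)
  rewrite ?iA1 ?iB1 ?iA2 ?iB2 //=; by case: (precedes _ _ _).
Qed.

Lemma is_profile_v n :
  is_profile (cands (2 ^ n.-1 + 2 ^ n.-1))
    [:: v1 n; v2 n; v3 n; v4 n].
Proof.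
have count_lo p : count p (A1 n) + count p (A2 n) = count p (iota 1 (2 ^ n.-1)).
  by rewrite -count_cat; apply/permP; rewrite perm_filterC.
have count_hi p : count p (B1 n) + count p (B2 n) =
                  count p (iota (2 ^ n.-1).+1 (2 ^ n.-1)).
  by rewrite -count_cat; apply/permP; rewrite perm_filterC.
(* Counting ignores both the order of the blocks and their reversal, so one criterion serves all
   four rows. *)
have permI (s : seq nat) :
    (forall p, count p s = count p (A1 n) + count p (A2 n) +
                           (count p (B1 n) + count p (B2 n))) ->
    perm_eq (cands (2 ^ n.-1 + 2 ^ n.-1)) s.
  move=> eq_s; apply/permP => p.
  by rewrite eq_s count_lo count_hi -count_cat /cands iotaD.
apply/and5P; split=> //; apply: permI => p;
  by rewrite !(count_cat, count_rev); lia.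
Qed.

(** * Pair counts in a bowtie *)

Lemma size_bowtie R S : size (bowtie R S) = size R.
Proof. by rewrite size_map size_iota. Qed.

Lemma nth_profile V R (s : nat) : is_profile V R -> s \in iota 1 (size R) ->
  perm_eq V (nth [::] R s.-1).
Proof.
by rewrite mem_iota => /all_nthP profR ltsR; apply: profR => /=; lia.
Qed.

Lemma is_profile_bowtie V W R S : size S = size R ->
  is_profile V R -> is_profile W S -> is_profile (V ++ W) (bowtie R S).
Proof.
move=> eqS profR profS; apply/allP => _ /mapP[s sR ->].
have permR := nth_profile V R s profR sR.
have permS : perm_eq W (nth [::] S s.-1) by apply: nth_profile; rewrite ?eqS.
by case: (odd s); [|rewrite perm_sym perm_catC perm_sym]; apply: perm_cat.
Qed.

(** Passes from rows to row numbers, whose parity decides the order of the two halves in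
    [bowtie]. *)
Lemma count_nth (p : pred (seq nat)) R :
  count (fun s => p (nth [::] R s.-1)) (iota 1 (size R)) = count p R.
Proof.
rewrite -[R in RHS](mkseq_nth [::]) /mkseq count_map -[1]addn0 iotaDl count_map.
exact: eq_count.
Qed.

Lemma count_odd_iota n : count odd (iota 1 n) = uphalf n.
Proof. by elim: n => // n IHn; rewrite -(addn1 n) iotaD count_cat IHn /=; lia. Qed.

Section Bowtie.

Variables (V W : seq nat) (R S : profile).
Hypotheses (eqS : size S = size R) (profR : is_profile V R).
Hypotheses (profS : is_profile W S) (VW0 : ~~ has (mem V) W).

Lemma notin_right i : i \in V -> i \notin W.
Proof. by move=> Vi; apply: contra VW0 => Wi; apply/hasP; exists i. Qed.

(** Common reduction for the three counts below: each row is decided from its number, given which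
    candidates occur in its two halves. *)
Lemma count_bowtie i j (p : pred nat) :
    (forall s, s \in iota 1 (size R) ->
    let r := nth [::] R s.-1 in let t := nth [::] S s.-1 in
    r =i V -> t =i W -> precedes i j (if odd s then r ++ t else t ++ r) = p s) ->
  count (precedes i j) (bowtie R S) = count p (iota 1 (size R)).
Proof.
move=> eq_p; rewrite count_map; apply: eq_in_count => s sR /=.
apply: eq_p => // x; first by rewrite -(perm_mem (nth_profile V R s profR sR)).
by rewrite -(perm_mem (nth_profile W S s profS _)) ?eqS.
Qed.

Lemma count_bowtie_left i j : i \in V -> j \in V ->
  count (precedes i j) (bowtie R S) = count (precedes i j) R.
Proof.
move=> Vi Vj; rewrite -(count_nth _ R); apply: count_bowtie => s sR r t rV tW.
by case: (odd s); rewrite precedes_cat ?rV ?tW ?Vj ?(negPf (notin_right _ _)).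
Qed.

Lemma count_bowtie_right i j : i \in W -> j \in W ->
  count (precedes i j) (bowtie R S) = count (precedes i j) S.
Proof.
move=> Wi Wj; rewrite -(count_nth _ S) eqS; apply: count_bowtie => s sR r t rV tW.
have notV k : k \in W -> (k \in V) = false.
  by move=> Wk; apply: contraTF Wk => /notin_right.
by case: (odd s); rewrite precedes_cat ?rV ?tW ?Wj ?notV.
Qed.

(** Odd rows place all of [V] before [W] and even rows the reverse; with an even number of rows both
    parities occur equally often. *)
Lemma count_bowtie_cross i j : ~~ odd (size R) ->
  (i \in V) && (j \in W) || (i \in W) && (j \in V) ->
  count (precedes i j) (bowtie R S) = (size R)./2.
Proof.
move=> evenR /orP[] /andP[iV jW].
  rewrite (count_bowtie i j odd) ?count_odd_iota; first by lia.
  move=> s sR r t rV tW.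
  have jV : j \notin V by apply: contraL jW; apply: notin_right.
  case: (odd s); rewrite precedes_cat ?rV ?tW jW ?iV ?(negPf jV) //=.
  by rewrite precedes_notin ?tW ?notin_right.
rewrite (count_bowtie i j (predC odd)).
  by have := count_predC odd (iota 1 (size R)); rewrite count_odd_iota size_iota; lia.
move=> s sR r t rV tW.
have iV' : i \notin V by apply: contraL iV; apply: notin_right.
rewrite /=; case: (odd s);
  rewrite precedes_cat ?rV ?tW jW ?iV ?(negPf (notin_right _ jW)) //=.
by rewrite precedes_notin ?rV.
Qed.

End Bowtie.

(** * A description of the arrows that does not depend on $n$ *)

(** Classes are indexed from 0 by [i.-1 %/ 8], which avoids the search over [q]. As neither [n] nor
    the range $[2^n]$ appears, the same relation serves at every level of the induction. *)
Definition arrow : rel nat := fun i j =>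
  if i.-1 %/ 8 == j.-1 %/ 8
  then E3 (i - 8 * (i.-1 %/ 8)) (j - 8 * (i.-1 %/ 8))
  else (i < j) == ~~ odd (i + j).

Lemma E3_cands i j : E3 i j -> (i \in cands 8) && (j \in cands 8).
Proof.
have /allP : all (fun a => (a.1 \in cands 8) && (a.2 \in cands 8)) arrows3 by [].
by move/(_ (i, j)).
Qed.

Lemma E3_asym i j : E3 i j -> ~~ E3 j i.
Proof.
have /allP : all (fun a => (a.2, a.1) \notin arrows3) arrows3 by [].
by move/(_ (i, j)).
Qed.

Lemma arrow_asym i j : arrow i j -> ~~ arrow j i.
Proof.
rewrite /arrow eq_sym; case: eqP => [->|neq_q]; first exact: E3_asym.
lia.
Qed.

Lemma E_arrow n i j : 3 <= n ->
  E n i j = [&& i \in cands (2 ^ n), j \in cands (2 ^ n) & arrow i j].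
Proof.
move=> n_ge3; rewrite /E /arrow; case: eqP => [->|_].
  case: (boolP (i \in cands 8)) => [|nVi]; last first.
    by apply: contraNF nVi => /E3_cands/andP[].
  case: (boolP (j \in cands 8)) => [|nVj]; last first.
    by move=> _; apply: contraNF nVj => /E3_cands/andP[].
  rewrite !mem_cands => lej lei; rewrite !divn_small ?eqxx ?subn0; lia.
have [Vi|//] := boolP (i \in cands (2 ^ n)).
have [Vj|//] /= := boolP (j \in cands (2 ^ n)).
have eq_n : 2 ^ n = 8 * 2 ^ (n - 3) by rewrite -(expnD 2 3) subnKC.
(* The class of [k] is unique and explicit, so it supplies the witness for both existential
   tests. *)
have CE q k : k \in cands (2 ^ n) -> q \in cands (2 ^ (n - 3)) ->
    C q k = (q == (k.-1 %/ 8).+1).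
  by rewrite /C !mem_cands; lia.
have Vq : (i.-1 %/ 8).+1 \in cands (2 ^ (n - 3)).
  by move: Vi; rewrite !mem_cands eq_n; lia.
have -> : same_class n i j = (i.-1 %/ 8 == j.-1 %/ 8).
  apply/hasP/eqP => [[q Wq]|eq_q].
    by rewrite !CE // => /andP[/eqP-> /eqP[]].
  by exists (i.-1 %/ 8).+1; rewrite // !CE // eq_q eqxx.
(* Different classes force [i != j], and then the disjunction in [E] agrees with the Boolean
   equality in [arrow]. *)
case: eqP => [eq_q | neq_q]; last by lia.
apply/hasP/idP => [[q Wq]|Eij].
  by rewrite CE // => /and3P[/eqP-> _]; rewrite subn1.
by exists (i.-1 %/ 8).+1; rewrite // !CE // eq_q eqxx /= subn1 -eq_q.
Qed.

(** Both class indices move by [h / 8], while positions inside a class, the order and the parity of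
    the sum are kept. Positivity matters because [0.-1] is 0. *)
Lemma arrow_same_half h i j : 8 %| h -> 0 < i -> 0 < j ->
  arrow (i + h) (j + h) = arrow i j.
Proof.
case/dvdnP=> k ->{h} i0 j0; rewrite /arrow.
have eq_q l : 0 < l -> (l + k * 8).-1 %/ 8 = l.-1 %/ 8 + k by lia.
rewrite !eq_q // eqn_add2r ltn_add2r; case: ifP => _; last by lia.
by congr (E3 _ _); lia.
Qed.

(** A cut at a multiple of 8 never splits a class, so separated candidates obey the parity rule. *)
Lemma arrow_cross h i j : 8 %| h -> 0 < i -> 0 < j -> (i <= h) != (j <= h) ->
  arrow i j = ((i < j) == ~~ odd (i + j)).
Proof. by case/dvdnP=> k -> *; rewrite /arrow; case: eqP => // eq_q; lia. Qed.

(** * The profiles $R_n$ and their pair counts *)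

Lemma cands_shift m h : [seq x + h | x <- cands m] = iota h.+1 m.
Proof.
by rewrite /cands -[in RHS](addn1 h) iotaDl; apply: eq_map => x; rewrite addnC.
Qed.

Lemma cands_double h : cands (h + h) = cands h ++ [seq x + h | x <- cands h].
Proof. by rewrite cands_shift /cands iotaD. Qed.

Lemma RprofS n : 3 <= n -> Rprof n.+1 =
  [:: v1 n.+1; v2 n.+1; v3 n.+1; v4 n.+1] ++
  bowtie (Rprof n) (shift (2 ^ n) (Rprof n)).
Proof. by case: n => [|[|[|n]]]. Qed.

Lemma size_Rprof n : 3 <= n -> size (Rprof n) = 4 * n - 2.
Proof.
elim: n => // n IHn; rewrite ltnS leq_eqVlt => /predU1P[<- //|n_ge3].
by rewrite RprofS // size_cat size_bowtie IHn //=; lia.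
Qed.

Lemma is_profile_shift h V R :
  is_profile V R -> is_profile [seq x + h | x <- V] (shift h R).
Proof.
by move=> /allP profR; apply/allP => _ /mapP[r /profR permR ->]; apply: perm_map.
Qed.

Lemma is_profile_Rprof n : 3 <= n -> is_profile (cands (2 ^ n)) (Rprof n).
Proof.
elim: n => // n IHn; rewrite ltnS leq_eqVlt => /predU1P[<- //|n_ge3].
rewrite RprofS // /is_profile all_cat expnS mul2n -addnn.
rewrite [X in X && _](is_profile_v n.+1) /= cands_double.
apply: is_profile_bowtie; rewrite ?size_map // ?is_profile_shift //; exact: IHn.
Qed.

Lemma count_Rprof n i j : 3 <= n -> i \in cands (2 ^ n) -> j \in cands (2 ^ n) ->
  i != j -> count (precedes i j) (Rprof n) = if arrow i j then 2 * n else 2 * n - 2.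
Proof.
elim: n i j => // n IHn i j; rewrite ltnS leq_eqVlt => /predU1P[<-|n_ge3].
  (* Base case by evaluation over all pairs in $[8]$; 6 and 4 are $2n$ and $2n-2$ at $n=3$. *)
  have /allP H : all (fun a => all (fun b => (a != b) ==>
    (count (precedes a b) R3 == if arrow a b then 6 else 4)) (cands 8)) (cands 8).
    by vm_compute.
  by move=> /H/allP Hi /Hi/implyP Hij /Hij/eqP.
rewrite RprofS // expnS mul2n -addnn => Vi Vj neq_ij.
rewrite count_cat (count_v n.+1 i j) //=.
have profR := is_profile_Rprof n n_ge3.
have profS := is_profile_shift (2 ^ n) _ _ profR.
set S := shift _ _ in profS *; set h := 2 ^ n in Vi Vj profR profS *.
have sizeS : size S = size (Rprof n) by rewrite size_map.
have dvd_h : 8 %| h by rewrite -[8]/(2 ^ 3) dvdn_exp2l.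
have VW0 : ~~ has (mem (cands h)) [seq x + h | x <- cands h].
  apply/hasPn => _ /mapP[x + ->] /=; rewrite !mem_cands; lia.
have hi k : k \in cands (h + h) -> h < k -> {l | l \in cands h & k = l + h}.
  by rewrite mem_cands => Vk hk; exists (k - h); rewrite ?mem_cands; lia.
case: eqP => [same | /eqP cross]; last first.
  (* The bowtie contributes half of $4n-2$, that is $2n-1$; adding 3 or 1 gives $2(n+1)$ or
     $2(n+1)-2$. *)
  rewrite (count_bowtie_cross _ _ _ _ sizeS profR profS VW0).
  - rewrite size_Rprof // (arrow_cross h) //; last 2 first.
    + by move: Vi; rewrite mem_cands; lia.
    + by move: Vj; rewrite mem_cands; lia.
    by case: (_ == _); lia.
  - by rewrite size_Rprof //; lia.
  by move: Vi Vj; rewrite cands_shift !mem_iota; lia.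
have [lei|hi_i] := leqP i h.
  have [Wi Wj] : i \in cands h /\ j \in cands h.
    by move: Vi Vj; rewrite !mem_cands; lia.
  rewrite (count_bowtie_left _ _ _ _ sizeS profR profS VW0) // IHn //.
  by case: arrow; lia.
have hi_j : h < j by lia.
have [i' Wi ei] := hi i Vi hi_i; have [j' Wj ej] := hi j Vj hi_j.
rewrite (count_bowtie_right _ _ _ _ sizeS profR profS VW0) ?ei ?ej ?(map_f (addn^~ h)) //.
rewrite arrow_same_half //; last 2 first.
- by move: Wi; rewrite mem_cands; case/andP.
- by move: Wj; rewrite mem_cands; case/andP.
rewrite count_map (eq_count (a2 := precedes i' j')); last first.
  by move=> r /=; apply: (precedes_map (addn^~ h)); apply: addIn.
rewrite IHn //; first by case: arrow; lia.
by apply: contra neq_ij => /eqP eq_ij; rewrite ei ej eq_ij.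
Qed.

Theorem theorem3 (n : nat) (hn : 3 <= n) :
  [/\ generates (cands (2 ^ n)) (E n) (Rprof n),
      generates (cands (2 ^ n)) (E n) (Rtilde n)
    & forall i j : nat, E n i j ->
        count (precedes i j) (Rprof n) = 2 * n /\
        count (precedes j i) (Rprof n) = 2 * n - 2].
Proof.
have size_R := size_Rprof n hn.
(* Only distinct candidates need a majority check: asymmetry of [arrow] excludes loops. *)
have generatesP R : is_profile (cands (2 ^ n)) R ->
    (forall i j, i \in cands (2 ^ n) -> j \in cands (2 ^ n) -> i != j ->
       arrow i j = (size R < 2 * count (precedes i j) R)) ->
    generates (cands (2 ^ n)) (E n) R.
  move=> profR arrowE; split=> // i j; rewrite E_arrow // /majority_arrow.
  case: (boolP (i \in _)) => // Vi; case: (boolP (j \in _)) => // Vj /=.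
  have [->|neq_ij] := eqVneq i j; last exact: arrowE.
  by apply/negP => ajj; have := arrow_asym _ _ ajj; rewrite ajj.
have profR := is_profile_Rprof n hn.
split.
- apply: generatesP => // i j Vi Vj nij.
  by rewrite count_Rprof // size_R; case: arrow; lia.
(* Deleting one row lowers a count by at most 1. An arrow keeps at least $2n-1$ of the $4n-3$ rows,
   still a majority, and a non-arrow has at most $2n-2$, so the content of the last row is
   irrelevant. *)
- have countR := fun i j => count_Rprof n i j hn.
  rewrite /Rtilde; case/lastP: (Rprof n) size_R profR countR => [|R r].
    by rewrite /=; lia.
  rewrite size_rcons /= -cats1 take_size_cat // => size_R.
  rewrite /is_profile all_cat => /andP[profR _] countR.
  apply: generatesP => // i j Vi Vj nij.
  have := countR i j Vi Vj nij; rewrite count_cat /= addn0.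
  by case: (precedes i j r); case: arrow; lia.
move=> i j; rewrite E_arrow // => /and3P[Vi Vj aij].
have neq_ij : i != j.
  apply: contraTN aij => /eqP->; apply/negP => ajj.
  by have := arrow_asym _ _ ajj; rewrite ajj.
rewrite !count_Rprof // 1?eq_sym // aij.
by rewrite (negPf (arrow_asym _ _ aij)).
Qed.
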